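(* Let $n\ge 1$ and $\mathbf{w}\in\mathcal{K}_{m+}\setminus\{\mathbf{0}\}\subset\mathbb{R}^n$, and let $\tau_i=\bigl(\sum_{j=1}^i w_j\bigr)^{-1}$ for $i=1,\dots,n$. The dual norm of $\Omega_{\mathbf{w}}$ is given, for every $\mathbf{x}\in\mathbb{R}^n$, by $$\Omega_{\mathbf{w}}^*(\mathbf{x})=\max\bigl\{\tau_i\,\|\mathbf{x}_{(i)}\|_1:\ i=1,\dots,n\bigr\}.$$
   Context: $\mathcal{K}_{m+}=\{\mathbf{x}\in\mathbb{R}^n: x_1\ge x_2\ge\cdots\ge x_n\ge 0\}$ is the monotone non-negative cone. The ordered weighted $\ell_1$ (OWL) norm is $\Omega_{\mathbf{w}}(\mathbf{x})=\sum_{i=1}^n w_i\,|x|_{[i]}$, where $|x|_{[1]}\ge\cdots\ge|x|_{[n]}$ are the absolute values of the components of $\mathbf{x}$ sorted in non-increasing order. The dual norm is $\Omega_{\mathbf{w}}^*(\mathbf{x})=\max\{\mathbf{u}^T\mathbf{x}:\ \mathbf{u}\in\mathbb{R}^n,\ \Omega_{\mathbf{w}}(\mathbf{u})\le 1\}$. For $\mathbf{x}\in\mathbb{R}^n$, $\mathbf{x}_{(i)}\in\mathbb{R}^i$ is the sub-vector of $\mathbf{x}$ consisting of its $i$ largest components in magnitude, so that $\|\mathbf{x}_{(i)}\|_1=\sum_{j=1}^i|x|_{[j]}$. *)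

(* Defs.v *)
(* MathComp + MathComp-Analysis: R is an arbitrary [realType], R^n is 'cV[R]_n. *)
From HB Require Import structures.
From mathcomp Require Import all_boot all_order all_algebra.
From mathcomp Require Import boolp classical_sets reals.

Set Implicit Arguments.
Unset Strict Implicit.
Unset Printing Implicit Defensive.

Import Order.TTheory GRing.Theory Num.Theory.

Local Open Scope classical_set_scope.
Local Open Scope ring_scope.

Definition monotone_nonneg_cone (R : realType) (n : nat) : set 'cV[R]_n :=
  [set x | (forall i j : 'I_n, (i <= j)%N -> x j 0 <= x i 0) /\
           (forall i : 'I_n, 0 <= x i 0)].

(* Entry [i] is |x|_[i+1]: indices start at 0. *)
Definition abs_sorted (R : realType) (n : nat) (x : 'cV[R]_n) : seq R :=
  sort >=%R [seq `|x i 0| | i <- enum 'I_n].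

Definition owl (R : realType) (n : nat) (w x : 'cV[R]_n) : R :=
  \sum_(i < n) w i 0 * (abs_sorted x)`_i.

Definition is_max (R : realType) (A : set R) (m : R) : Prop :=
  A m /\ ubound A m.

Definition dual_values (R : realType) (n : nat) (N : 'cV[R]_n -> R)
    (x : 'cV[R]_n) : set R :=
  [set (u^T *m x) 0 0 | u in [set u : 'cV[R]_n | N u <= 1]].

(* [sup] is total and is the maximum whenever the maximum exists; attainment
   has to be stated separately, as [is_max (dual_values N x) (dual_norm N x)]. *)
Definition dual_norm (R : realType) (n : nat) (N : 'cV[R]_n -> R)
    (x : 'cV[R]_n) : R :=
  sup (dual_values N x).

Definition l1_norm (R : realType) (n : nat) (x : 'cV[R]_n) : R :=
  \sum_(i < n) `|x i 0|.

(* The [k] signed components of x that are largest in magnitude ([k <= n]);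
   [sort] is stable, so ties are broken in favour of the smaller index. *)
Definition largest_subvector (R : realType) (n : nat) (x : 'cV[R]_n) (k : nat) :
    'cV[R]_k :=
  \col_(j < k)
    (sort (fun a b : R => `|b| <= `|a|) [seq x i 0 | i <- enum 'I_n])`_j.

Lemma l1_norm_largest_subvector (R : realType) (n : nat) (x : 'cV[R]_n)
    (k : nat) :
  l1_norm (largest_subvector x k) = \sum_(j < k) (abs_sorted x)`_j.
Proof.
apply: eq_bigr => j _; rewrite mxE; set s := sort _ _.
have -> : abs_sorted x = [seq `|a| | a <- s].
  by rewrite /s (map_sort (leT := >=%R)) // -map_comp.
case: (ltnP j (size s)) => js; first by rewrite (nth_map 0).
by rewrite !nth_default ?size_map ?normr0.
Qed.

(* [tau w i] is tau_(i+1): the partial sum includes the index [i]. *)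
Definition tau (R : realType) (n : nat) (w : 'cV[R]_n) (i : 'I_n) : R :=
  (\sum_(j < n | (j <= i)%N) w j 0)^-1.

(* Main.v *)
(* Upper bound: Abel summation along an ordering of u by decreasing magnitude
   compares u^T x with M * owl w u, because every partial sum of the |x_j| is at
   most M times the corresponding partial sum of w, where M is the claimed
   maximum.  Attainment: if the index k realizes M, take u = tau_k * sgn x_j on
   the k largest entries of x and 0 elsewhere. *)
Require Import Defs.
From HB Require Import structures.
From mathcomp Require Import all_boot all_order all_algebra.
From mathcomp Require Import fingroup perm.
From mathcomp Require Import boolp classical_sets reals.

Import Order.TTheory GRing.Theory Num.Theory.

Local Open Scope classical_set_scope.
Local Open Scope ring_scope.

Lemma is_max_sup (R : realType) (A : set R) (m : R) : is_max A m -> sup A = m.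
Proof.
move=> [Am ubm]; apply/eqP; rewrite eq_le; apply/andP; split.
  by apply: ge_sup => //; exists m.
by apply: ub_le_sup => //; exists m.
Qed.

(** Trades the sorted list for a permutation sending ranks to entries, so that comparing two
    orderings becomes reindexing a sum. *)
Lemma abs_sorted_perm (R : realType) (n : nat) (x : 'cV[R]_n) :
  exists s : 'S_n, forall i : 'I_n, (abs_sorted x)`_i = `|x (s i) 0|.
Proof.
have /tuple_permP[s es] : perm_eq (abs_sorted x) [tuple `|x i 0| | i < n].
  by rewrite /abs_sorted perm_sort.
by exists s => i; rewrite es -tnth_nth !tnth_mktuple.
Qed.

Lemma abs_sorted_antitone (R : realType) (n : nat) (x : 'cV[R]_n) (i j : 'I_n) :
  (i <= j)%N -> (abs_sorted x)`_j <= (abs_sorted x)`_i.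
Proof.
move=> ij; have sz : size (abs_sorted x) = n.
  by rewrite size_sort size_map size_enum_ord.
have srt : sorted >=%R (abs_sorted x) by apply: sort_sorted => a b; exact: le_total.
have ge_tr : transitive (>=%R : rel R) by move=> b a c ba cb; apply: le_trans cb ba.
by apply: (sorted_leq_nth ge_tr (@lexx _ R) 0 srt); rewrite ?inE ?sz.
Qed.

Lemma sum_ordS_le (V : nmodType) (n k : nat) (kn : (k.+1 < n)%N) (F : 'I_n -> V) :
  \sum_(j < n | (j <= k.+1)%N) F j =
  \sum_(j < n | (j <= k)%N) F j + F (Ordinal kn).
Proof.
rewrite (bigD1 (Ordinal kn)) //= addrC; congr (_ + _).
apply: eq_bigl => j; rewrite -val_eqE /=.
by rewrite [in LHS]leq_eqVlt ltnS; case: eqP => [->|]; rewrite ?ltnn ?andbT ?andbF.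
Qed.

(** Abel summation by induction on [k]: the partial sum up to [k] is nonnegative, so its coefficient
    can be raised from the value of [a] at [k.+1] to the value at [k], where the induction
    hypothesis applies. *)
Lemma antitone_sum_ge (R : realDomainType) (n : nat) (a d : 'I_n -> R)
    (a_anti : forall i j : 'I_n, (i <= j)%N -> a j <= a i)
    (d_ge0 : forall k : 'I_n, 0 <= \sum_(j < n | (j <= k)%N) d j) (k : 'I_n) :
  a k * \sum_(j < n | (j <= k)%N) d j <= \sum_(j < n | (j <= k)%N) a j * d j.
Proof.
case: k => k; elim: k => [|k IHk] kn /=.
  rewrite mulr_sumr le_eqVlt; apply/orP; left; apply/eqP/eq_bigr => j.
  rewrite leqn0 => /eqP j0; congr (a _ * _); exact: val_inj.
rewrite !sum_ordS_le mulrDr lerD2r; apply: le_trans _ (IHk (ltnW kn)).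
by apply: ler_wpM2r; [exact: (d_ge0 (Ordinal (ltnW kn)))|apply: a_anti => /=].
Qed.

(** Take [d = c - b] in [antitone_sum_ge] at the last index: the lower bound there is a product of
    two nonnegative factors. *)
Lemma antitone_sum_le (R : realDomainType) (n : nat) (a b c : 'I_n -> R)
    (a_anti : forall i j : 'I_n, (i <= j)%N -> a j <= a i)
    (a_ge0 : forall i : 'I_n, 0 <= a i)
    (bc : forall k : 'I_n,
      \sum_(j < n | (j <= k)%N) b j <= \sum_(j < n | (j <= k)%N) c j) :
  \sum_(j < n) a j * b j <= \sum_(j < n) a j * c j.
Proof.
case: n => [|n] in a b c a_anti a_ge0 bc *; first by rewrite !big_ord0.
have d_ge0 (k : 'I_n.+1) : 0 <= \sum_(j < n.+1 | (j <= k)%N) (c j - b j).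
  by rewrite sumrB subr_ge0.
have all_le (F : 'I_n.+1 -> R) :
    \sum_(j < n.+1 | (j <= @ord_max n)%N) F j = \sum_(j < n.+1) F j.
  by apply: eq_bigl => j; rewrite -ltnS ltn_ord.
rewrite -subr_ge0 -sumrB; under eq_bigr do rewrite -mulrBr.
rewrite -all_le; apply: le_trans _ (antitone_sum_ge _ _ _ _ a_anti d_ge0 ord_max).
exact: mulr_ge0.
Qed.

Lemma card_ord_le (n : nat) (k : 'I_n) : #|[set i : 'I_n | (i <= k)%N]%SET| = k.+1.
Proof.
rewrite -sum1_card -[RHS]card_ord -sum1_card (big_ord_widen n (fun=> 1%N)) //.
by apply: eq_bigl => i; rewrite inE.
Qed.

(* Both sums can be compared termwise with the value of [c] at index [k] after
   removing the common indices. *)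
Lemma sum_le_initial (R : realDomainType) (n : nat) (c : 'I_n -> R)
    (c_anti : forall i j : 'I_n, (i <= j)%N -> c j <= c i)
    (k : 'I_n) (A : {set 'I_n}) :
  #|A| = k.+1 -> \sum_(i in A) c i <= \sum_(i < n | (i <= k)%N) c i.
Proof.
move=> cardA; pose B := [set i : 'I_n | (i <= k)%N]%SET.
have cardB : #|B| = k.+1 by exact: card_ord_le.
have -> : \sum_(i < n | (i <= k)%N) c i = \sum_(i in B) c i.
  by apply: eq_bigl => i; rewrite inE.
rewrite (big_setID B) [leRHS](big_setID A) /= finset.setIC lerD2l.
have card_eq : #|A :\: B| = #|B :\: A|.
  by rewrite !cardsD finset.setIC cardA cardB.
apply: (@le_trans _ _ (c k *+ #|A :\: B|)); last rewrite card_eq.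
  rewrite -sumr_const; apply: ler_sum => i; rewrite !inE -ltnNge => /andP[ki _].
  exact/c_anti/ltnW.
rewrite -sumr_const; apply: ler_sum => i; rewrite !inE => /andP[_ ik].
exact: c_anti.
Qed.

(** By injectivity, [s] maps the first [k.+1] indices onto a set of the same size. *)
Lemma sum_perm_le_initial (R : realDomainType) (n : nat) (c : 'I_n -> R)
    (c_anti : forall i j : 'I_n, (i <= j)%N -> c j <= c i)
    (k : 'I_n) (s : 'S_n) :
  \sum_(i < n | (i <= k)%N) c (s i) <= \sum_(i < n | (i <= k)%N) c i.
Proof.
pose A := [set s i | i in [set i : 'I_n | (i <= k)%N]]%SET.
have -> : \sum_(i < n | (i <= k)%N) c (s i) = \sum_(i in A) c i.
  rewrite big_imset /=; last by move=> ? ? _ _; exact: perm_inj.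
  by apply: eq_bigl => i; rewrite inE.
apply: sum_le_initial => //; rewrite card_imset; last exact: perm_inj.
exact: card_ord_le.
Qed.

Lemma cone_partial_sum_gt0 (R : realType) (n : nat) (w : 'cV[R]_n)
    (hw : monotone_nonneg_cone w) (hw0 : w != 0) (i : 'I_n) :
  0 < \sum_(j < n | (j <= i)%N) w j 0.
Proof.
case: hw => w_anti w_ge0; have n_gt0 := leq_ltn_trans (leq0n i) (ltn_ord i).
pose o := Ordinal n_gt0.
(* The first entry dominates all the others, so its vanishing would force [w = 0]. *)
have wo : 0 < w o 0.
  rewrite lt_def w_ge0 andbT; apply: contra hw0 => /eqP w0.
  apply/eqP/colP => j; rewrite mxE; apply/eqP.
  by rewrite eq_le w_ge0 -{1}w0 w_anti.
rewrite (bigD1 o) //=; apply: ltr_wpDr => //.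
by apply: sumr_ge0 => j _; exact: w_ge0.
Qed.

Lemma l1_norm_largest_ord (R : realType) (n : nat) (x : 'cV[R]_n) (k : 'I_n) :
  l1_norm (largest_subvector x k.+1) =
  \sum_(j < n | (j <= k)%N) (abs_sorted x)`_j.
Proof.
rewrite l1_norm_largest_subvector.
by rewrite (big_ord_widen n (fun j => (abs_sorted x)`_j)).
Qed.

Lemma sum_perm_le_l1_norm_largest (R : realType) (n : nat) (x : 'cV[R]_n)
    (k : 'I_n) (q : 'S_n) :
  \sum_(j < n | (j <= k)%N) `|x (q j) 0| <= l1_norm (largest_subvector x k.+1).
Proof.
have [p px] := abs_sorted_perm _ _ x; rewrite l1_norm_largest_ord.
(* Products of permutations act from left to right: [q * p^-1] sends [j] to the rank of the entry
   [q j] in the sorted list of [x]. *)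
apply: le_trans _ (sum_perm_le_initial _ _ _ (@abs_sorted_antitone _ _ x) k (q * p^-1)%g).
by apply: ler_sum => j _; rewrite px permM permKV.
Qed.

Lemma dual_values_le (R : realType) (n : nat) (w : 'cV[R]_n) (x : 'cV[R]_n)
    (M : R) (M_ge0 : 0 <= M)
    (xM : forall k : 'I_n, l1_norm (largest_subvector x k.+1) <=
                           M * \sum_(j < n | (j <= k)%N) w j 0) :
  ubound (dual_values (owl w) x) M.
Proof.
move=> _ [u /= u1 <-]; have [q qu] := abs_sorted_perm _ _ u.
apply: (@le_trans _ _ (\sum_(j < n) (abs_sorted u)`_j * `|x (q j) 0|)).
  rewrite mxE (reindex_perm q) /=; apply: ler_sum => j _.
  by rewrite mxE qu -normrM ler_norm.
(* The sorted magnitudes of [u] serve as antitone weights; the new sum is [M * owl w u], hence at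
   most [M]. *)
apply: (@le_trans _ _ (\sum_(j < n) (abs_sorted u)`_j * (M * w j 0))).
  apply: antitone_sum_le => [i j|i|k]; first exact: abs_sorted_antitone.
    by rewrite qu.
  rewrite -mulr_sumr; apply: le_trans _ (xM k).
  exact: sum_perm_le_l1_norm_largest.
under eq_bigr do rewrite mulrCA [X in M * X]mulrC.
by rewrite -mulr_sumr ler_piMr.
Qed.

Lemma dual_values_largest (R : realType) (n : nat) (w : 'cV[R]_n)
    (hw : monotone_nonneg_cone w) (hw0 : w != 0) (x : 'cV[R]_n) (k : 'I_n) :
  dual_values (owl w) x (tau w k * l1_norm (largest_subvector x k.+1)).
Proof.
have W_gt0 := cone_partial_sum_gt0 _ _ _ hw hw0 k; case: hw => w_anti w_ge0.
have tau_ge0 : 0 <= tau w k by rewrite invr_ge0 ltW.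
have [p px] := abs_sorted_perm _ _ x.
(* [p^-1 i] is the rank of entry [i] in [x]; testing ranks rather than magnitudes keeps exactly
   [k.+1] positions even when there are ties. *)
pose u : 'cV[R]_n :=
  \col_i (if ((p^-1)%g i <= k)%N then tau w k * Num.sg (x i 0) else 0).
exists u => /=; last first.
  rewrite mxE (reindex_perm p) /= l1_norm_largest_ord mulr_sumr [RHS]big_mkcond.
  apply: eq_bigr => j _; rewrite !mxE permK px.
  by case: ifP; rewrite ?mul0r // normrEsg mulrA.
have [q qu] := abs_sorted_perm _ _ u.
(* Only an inequality, since the sign of a zero entry of [x] is 0. *)
have abs_u i : `|u i 0| <= if ((p^-1)%g i <= k)%N then tau w k else 0.
  rewrite mxE; case: ifP; rewrite ?normr0 // => _.
  rewrite normrM (ger0_norm tau_ge0) normr_sg ler_piMr //.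
  by case: (_ != 0).
have -> : 1 = tau w k * \sum_(j < n | (j <= k)%N) w j 0.
  by rewrite mulVf // gt_eqF.
(* [s] turns ranks in [x] into ranks in [u], so after reindexing only the weights [w (s j)] with
   [j <= k] remain, each with a factor at most [tau w k]. *)
pose s := (p * q^-1)%g.
apply: le_trans _ (ler_wpM2l tau_ge0
  (sum_perm_le_initial _ _ (fun j => w j 0) w_anti k s)).
rewrite /owl (reindex_perm s) mulr_sumr [leRHS]big_mkcond /=.
apply: ler_sum => j _; rewrite qu permM permKV.
apply: le_trans (ler_wpM2l (w_ge0 _) (abs_u _)) _.
by rewrite permK; case: ifP; rewrite ?mulr0 // mulrC.
Qed.

(* All the terms of the maximum on the right are nonnegative and n > 0, so the
   neutral element 0 does not affect its value. *)
Theorem lemma1 (R : realType) (n : nat) (hn : (0 < n)%N) (w : 'cV[R]_n)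
    (hw : monotone_nonneg_cone w) (hw0 : w != 0) (x : 'cV[R]_n) :
  is_max (dual_values (owl w) x) (dual_norm (owl w) x) /\
  dual_norm (owl w) x =
    \big[Num.max/0]_(i < n) (tau w i * l1_norm (largest_subvector x i.+1)).
Proof.
set M := \big[_/_]_(i < n) _.
have W_gt0 := cone_partial_sum_gt0 _ _ _ hw hw0.
have term_ge0 (i : 'I_n) : 0 <= tau w i * l1_norm (largest_subvector x i.+1).
  by rewrite mulr_ge0 ?invr_ge0 ?(ltW (W_gt0 i)) // sumr_ge0.
have le_M (i : 'I_n) : tau w i * l1_norm (largest_subvector x i.+1) <= M.
  exact: le_bigmax.
suff maxM : is_max (dual_values (owl w) x) M.
  by rewrite /dual_norm (is_max_sup _ _ _ maxM).
split.
  have [k _ ->] : {k | k \in xpredT &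
      M = tau w k * l1_norm (largest_subvector x k.+1)}.
    exact: eq_bigmax (Ordinal hn) _ _ _ _.
  exact: dual_values_largest.
apply: dual_values_le => [|k]; first exact: le_trans _ (le_M (Ordinal hn)).
(* Dividing by the positive partial sum of [w] turns the required bound into [le_M k]. *)
by rewrite -ler_pdivrMr // mulrC; exact: le_M.
Qed.
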